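(* Let $P \subseteq \mathbb{R}^N$ be a cooperahedron, with associated game $(\mathcal{F}_P, v_P)$, set $I^*_P$ of indices of strict inequalities, and associated sets $S_i$, $i \in I_P$. Then $P$ is nonempty if and only if $(\mathcal{F}_P, v_P)$ is balanced and $$\mathcal{E}(\mathcal{F}_P, v_P) \cap \{S_i \mid i \in I^*_P\} = \emptyset .$$
   Context: Let $N$ be a finite set of players. Coalitions are the nonempty subsets of $N$, $\mathbf{1}^S \in \mathbb{R}^N$ denotes the indicator vector of $S \subseteq N$, and $\langle\cdot,\cdot\rangle$ is the usual scalar product on $\mathbb{R}^N$. A cooperahedron is a polyhedron $P \subseteq \mathbb{R}^N$ of the form $$P = \{x \in \mathbb{R}^N \mid \langle \mathbf{1}^N, x\rangle = b^0 \text{ and } \langle z^i, x \rangle \diamond_i b^i \text{ for all } i \in I_P\},$$ where $I_P$ is finite and, for all $i \in I_P$, $\diamond_i \in \{\ge, >, <, \le\}$ and $z^i \in \{0,1\}^N$ (and $b^0, b^i \in \mathbb{R}$). Let $I^\prec_P = \{i \in I_P \mid \diamond_i \in \{<,\le\}\}$, $I^\succ_P = \{i \in I_P \mid \diamond_i \in \{\ge,>\}\}$ and $I^*_P = \{i \in I_P \mid \diamond_i \in \{<,>\}\}$. For each $i \in I_P$, associate with $z^i$ the coalition $S_i = \{j \in N \mid z^i_j = 1\}$ if $i \in I^\succ_P$, and $S_i = \{j \in N \mid z^i_j = 0\}$ if $i \in I^\prec_P$. (When $x(N)=\sum_{j\in N}x_j=b^0$, an inequality $\langle z^i,x\rangle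 \le b^i$, resp. $< b^i$, is equivalent to $x(S_i)\ge b^0-b^i$, resp. $> b^0-b^i$.) The game $(\mathcal{F}_P, v_P)$ associated with $P$ is defined on the set system $\mathcal{F}_P = \{S_i \mid i \in I_P\}$ by $v_P(S_i) = b^i$ if $i \in I^\succ_P$ and $v_P(S_i) = b^0 - b^i$ if $i \in I^\prec_P$; the total amount to be allocated to the players of $N$ is $b^0$. A collection $\mathcal{B}$ of coalitions is balanced on $N$ if there are positive weights $(\lambda_S)_{S \in \mathcal{B}}$ with $\sum_{S\in\mathcal{B}} \lambda_S \mathbf{1}^S = \mathbf{1}^N$. The game $(\mathcal{F}_P, v_P)$ is balanced if, for all balanced collections $\mathcal{B} \subseteq \mathcal{F}_P$ with such weights, $\sum_{S\in\mathcal{B}} \lambda_S v_P(S) \le b^0$. The set $\mathcal{E}(\mathcal{F}_P, v_P)$ of effective coalitions consists of the coalitions belonging to some balanced collection $\mathcal{B} \subseteq \mathcal{F}_P$, $\mathcal{B} \neq \{N\}$, for which there exist such weights with $\sum_{S\in\mathcal{B}} \lambda_S v_P(S) = b^0$.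
   Formalization: Added: if N = S_i for a strict inequality i then v_P(N) ≠ b^0 (else the single inequality x(N) > b^0 is a counterexample, as E excludes the collection {N}). Also explicit: N is nonempty, every S_i is nonempty, and v_P is well defined. *)

(* Defs.v *)
From mathcomp Require Import all_boot all_order all_algebra.
From mathcomp Require Import boolp reals.
Set Implicit Arguments.
Unset Strict Implicit.
Unset Printing Implicit Defensive.
Import Order.TTheory GRing.Theory Num.Theory.
Local Open Scope ring_scope.

Section Vectors.
Context {R : realType} {N : finType}.

Definition dot (u x : {ffun N -> R}) : R := \sum_j u j * x j.

Definition indicator (S : {set N}) : {ffun N -> R} := [ffun j => (j \in S)%:R].

(* The inclusion of {0,1}^N, encoded as {ffun N -> bool}, into R^N. *)
Definition vec01 (z : {ffun N -> bool}) : {ffun N -> R} :=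
  [ffun j => (z j)%:R].

End Vectors.

Section Games.
Context {R : realType} {N : finType}.

(* [lam] is only relevant on [B]. The first clause says that the members of
   [B] are coalitions, i.e. nonempty. *)
Definition balancing_weights (B : {set {set N}}) (lam : {set N} -> R) : Prop :=
  [/\ set0 \notin B,
      forall S, S \in B -> 0 < lam S &
      forall j, \sum_(S in B) lam S * indicator S j = indicator [set: N] j].

(* A game on the set system [F] is given by [v], of which only the values on
   [F] matter, together with the amount [b0] to be allocated to [N]; [N] need
   not belong to [F], and even if it does, [v [set: N]] need not be [b0]. *)
Definition balanced_game (F : {set {set N}}) (v : {set N} -> R) (b0 : R) :
    Prop :=
  forall (B : {set {set N}}) (lam : {set N} -> R),
    B \subset F -> balancing_weights B lam ->
    \sum_(S in B) lam S * v S <= b0.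

Definition effective (F : {set {set N}}) (v : {set N} -> R) (b0 : R) :
    {set {set N}} :=
  [set S | `[< exists (B : {set {set N}}) (lam : {set N} -> R),
       [/\ B \subset F, B != [set [set: N]], balancing_weights B lam,
           S \in B & \sum_(T in B) lam T * v T = b0] >]].

End Games.

Inductive ineq := Ge | Gt | Lt | Le.

Definition ineq_holds {R : realType} (c : ineq) (a b : R) : bool :=
  match c with
  | Ge => a >= b
  | Gt => a > b
  | Lt => a < b
  | Le => a <= b
  end.

Definition ineq_prec (c : ineq) : bool :=
  match c with Lt | Le => true | Ge | Gt => false end.

Definition ineq_strict (c : ineq) : bool :=
  match c with Lt | Gt => true | Ge | Le => false end.

(* A cooperahedron is identified with the system of inequalities defining it,
   since the associated game depends on that system and not only on its set of
   solutions, which is [solutions] below. *)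
Record cooperahedron (R : realType) (N : finType) := Cooperahedron {
  index_set : finType;
  total_amount : R;
  normal_vector : index_set -> {ffun N -> bool};
  symb : index_set -> ineq;
  bound : index_set -> R
}.

Section Cooperahedra.
Context {R : realType} {N : finType} (P : cooperahedron R N).

Definition solutions : pred {ffun N -> R} :=
  [pred x | (dot (indicator [set: N]) x == total_amount P) &&
    [forall i : index_set P,
       ineq_holds (symb i) (dot (vec01 (normal_vector i)) x) (bound i)]].

Definition prec_indices : {set index_set P} :=
  [set i : index_set P | ineq_prec (symb i)].
Definition succ_indices : {set index_set P} :=
  [set i : index_set P | ~~ ineq_prec (symb i)].
Definition strict_indices : {set index_set P} :=
  [set i : index_set P | ineq_strict (symb i)].

(* On the hyperplane x(N) = b0, an upper bound b on x(S) is the lower bound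
   b0 - b on x(~: S); hence the complement here and the values of
   [associated_game] below. *)
Definition coalition (i : index_set P) : {set N} :=
  if i \in succ_indices then [set j | normal_vector i j]
  else [set j | ~~ normal_vector i j].

Definition set_system : {set {set N}} := [set coalition i | i : index_set P].

Definition strict_coalitions : {set {set N}} :=
  [set coalition i | i in strict_indices].

(* Such a [v] exists if and only if any two indices with the same coalition
   prescribe the same value, i.e. the associated game is well defined; it is
   then unique on [set_system]. *)
Definition associated_game (v : {set N} -> R) : Prop :=
  (forall i, i \in succ_indices -> v (coalition i) = bound i) /\
  (forall i, i \in prec_indices -> v (coalition i) = total_amount P - bound i).

End Cooperahedra.

(* Main.v *)
Require Import Defs.
From mathcomp Require Import all_boot all_order all_algebra.
From mathcomp Require Import boolp reals.
From mathcomp Require Import ring lra.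
Import Order.TTheory GRing.Theory Num.Theory.
Local Open Scope ring_scope.

(** Summing the inequalities with balancing weights shows that the conditions
    are necessary. Conversely, if the system is infeasible, Motzkin's
    transposition theorem (proved by Fourier-Motzkin elimination) gives
    nonnegative multipliers of the [1^S] whose combination is [c 1^N], while the
    same combination of the [v S] is at least [c b0], with equality only if a
    strict inequality has a positive multiplier. Coalitions are nonempty, so
    [c > 0], and after division by [c] the support is a balanced collection that
    either violates balancedness or makes a strict coalition effective. *)

(** * Fourier-Motzkin elimination of one variable *)

(* Rows of the system obtained by eliminating a variable with coefficients [c]:
   a pair of rows with opposite signs yields their combination cancelling it, a
   pair [(p, q)] with [c p = 0] yields row [p], and the other pairs yield the
   trivial row [0 <= 0]. *)
Definition fm_weight {R : realFieldType} {I : finType} (c : I -> R)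
    (k : I * I) (i : I) : R :=
  if (0 < c k.1) && (c k.2 < 0) then
    - c k.2 * (i == k.1)%:R + c k.1 * (i == k.2)%:R
  else if c k.1 == 0 then (i == k.1)%:R else 0.

Lemma sum_deltal {R : realFieldType} {I : finType} (k : I) (f : I -> R) :
  \sum_i (i == k)%:R * f i = f k.
Proof.
rewrite (bigD1 k) //= eqxx mul1r big1 ?addr0// => i /negbTE ->.
by rewrite mul0r.
Qed.

Lemma fm_weight_sum {R : realFieldType} {I : finType} (c f : I -> R) k :
  \sum_i fm_weight c k i * f i =
  if (0 < c k.1) && (c k.2 < 0) then c k.1 * f k.2 - c k.2 * f k.1
  else if c k.1 == 0 then f k.1 else 0.
Proof.
rewrite /fm_weight; case: ifP => _; last case: ifP => _.
- under eq_bigr do rewrite mulrDl -!mulrA.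
  by rewrite big_split -!mulr_sumr !sum_deltal addrC mulNr.
- exact: sum_deltal.
- by rewrite big1 // => i _; rewrite mul0r.
Qed.

Lemma fm_weight_ge0 {R : realFieldType} {I : finType} (c : I -> R) k i :
  0 <= fm_weight c k i.
Proof.
rewrite /fm_weight; case: ifP => [/andP[c1 c2]|_]; last by case: ifP.
by rewrite addr_ge0 ?mulr_ge0 ?oppr_ge0 // ltW.
Qed.

Definition fm_strict {R : realFieldType} {I : finType} (c : I -> R)
    (s : pred I) (k : I * I) : bool :=
  [exists i, s i && (0 < fm_weight c k i)].

(** The midpoint of the largest lower bound and the smallest upper bound works: a strict lower bound
    is at most the former and, by hypothesis, strictly below the latter; symmetrically for upper
    bounds. *)
Lemma exists_between {R : realFieldType} {I : finType} (L U s : pred I)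
    (f g : I -> R) :
  (forall p q, L p -> U q -> f p < g q ?<= if ~~ (s p || s q)) ->
  exists t, (forall p, L p -> f p < t ?<= if ~~ s p) /\
            (forall q, U q -> t < g q ?<= if ~~ s q).
Proof.
move=> fg.
have [p0 Lp0|L0] := pickP L; have [q0 Uq0|U0] := pickP U.
- case: (@arg_maxP _ _ _ p0 L f Lp0) => p Lp maxp.
  case: (@arg_minP _ _ _ q0 U g Uq0) => q Uq minq.
  have := fg p q Lp Uq => /lteifW fpq.
  exists ((f p + g q) / 2); split => [p' Lp'|q' Uq'].
  + have := fg _ _ Lp' Uq; have := maxp _ Lp'.
    by case: (s p') => /= h1 h2 //; last move/lteifW: h2 => h2; lra.
  + have := fg _ _ Lp Uq'; have := minq _ Uq'.
    rewrite orbC.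
    by case: (s q') => /= h1 h2 //; last move/lteifW: h2 => h2; lra.
- case: (@arg_maxP _ _ _ p0 L f Lp0) => p Lp maxp.
  exists (f p + 1); split => [p' Lp'|q]; last by rewrite U0.
  by have := maxp _ Lp'; case: (s p') => /= h; lra.
- case: (@arg_minP _ _ _ q0 U g Uq0) => q Uq minq.
  exists (g q - 1); split => [p|q' Uq']; first by rewrite L0.
  by have := minq _ Uq'; case: (s q') => /= h; lra.
- by exists 0; split => p; rewrite ?L0 ?U0.
Qed.

(** Rows with [c i > 0] bound [t] from below by [g i / c i], rows with [c i < 0] bound it from
    above, and the combined rows say that these bounds are compatible. Rows with [c i = 0] survive
    as the pairs [(i, i)]. *)
Lemma solve_one_variable {R : realFieldType} {I : finType} (c g : I -> R)
    (s : pred I) :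
  (forall k, \sum_i fm_weight c k i * g i < 0 ?<= if ~~ fm_strict c s k) ->
  exists t, forall i, g i < t * c i ?<= if ~~ s i.
Proof.
move=> H.
have [|t [tL tU]] := @exists_between R I (fun i => 0 < c i) (fun i => c i < 0)
    s (fun i => g i / c i) (fun i => g i / c i).
  move=> p q /= cp cq; have := H (p, q).
  rewrite fm_weight_sum /= cp cq /= => Hpq.
  have {}Hpq : c p * g q - c q * g p < 0 ?<= if ~~ (s p || s q).
    apply: lteif_imply Hpq; apply/implyP; apply: contra => spq.
    apply/existsP; case/orP: spq => sp; [exists p|exists q];
      rewrite sp /fm_weight /= cp cq /= eqxx; case: eqP => _ /=; lra.
  (* The two bounds differ by the combined row divided by a positive number. *)
  have -> : g p / c p = g q / c q + (c p * g q - c q * g p) / (c p * - c q).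
    by field; rewrite (lt0r_neq0 cp) (ltr0_neq0 cq).
  rewrite -lteifBrDl subrr lteif_pdivrMr ?mul0r //.
  by rewrite mulr_gt0 ?oppr_gt0.
exists t => i; case: (ltrgt0P (c i)) => ci.
- by rewrite -lteif_pdivrMr //; exact: tL.
- by rewrite -lteif_ndivlMr //; exact: tU.
- have := H (i, i); rewrite fm_weight_sum /= ci ltxx eqxx mulr0 /=.
  apply: lteif_imply; apply/implyP; apply: contra => si.
  by apply/existsP; exists i; rewrite si /fm_weight /= ci ltxx !eqxx /= ltr01.
Qed.

(** * Motzkin's transposition theorem *)

(** Induction on a list [J] of variables containing all those that occur. The row type [I] is
    generalized, since elimination replaces it by [I * I]; multipliers of the reduced system pull
    back through [fm_weight]. *)
Lemma motzkin_supp {R : realFieldType} {N : finType} (J : seq N) (I : finType)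
    (a : I -> N -> R) (b : I -> R) (s : pred I) :
  (forall i j, j \notin J -> a i j = 0) ->
  (exists x : N -> R, forall i, b i < \sum_j a i j * x j ?<= if ~~ s i) \/
  (exists mu : I -> R,
    [/\ forall i, 0 <= mu i,
        forall j, \sum_i mu i * a i j = 0 &
        0 < \sum_i mu i * b i ?<= if [exists i, s i && (0 < mu i)]]).
Proof.
elim: J I a b s => [|j0 J IH] I a b s a0.
  (* Without variables, a violated row is by itself a certificate of infeasibility. *)
  have [i0 /= nbi|/= bi] := pickP (fun i => ~~ (b i < 0 ?<= if ~~ s i)).
    right; exists (fun i => (i == i0)%:R); split => [i|j|]; first by [].
      by rewrite sum_deltal a0.
    rewrite sum_deltal; move: nbi; rewrite -lteifNE negbK.
    apply: lteif_imply; apply/implyP => si; apply/existsP; exists i0.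
    by rewrite si eqxx ltr01.
  left; exists (fun=> 0) => i; rewrite big1; last by move=> j _; rewrite mulr0.
  by have /negbFE := bi i.
pose c i := a i j0.
have reduced_supp k j : j \notin J -> \sum_i fm_weight c k i * a i j = 0.
  move=> jJ; have [->|jj0] := eqVneq j j0; last first.
    by apply: big1 => i _; rewrite a0 ?mulr0 // inE negb_or jj0.
  rewrite fm_weight_sum; case: ifP => _; first by rewrite /c mulrC subrr.
  by case: ifP => // /eqP.
case: (IH _ (fun k j => \sum_i fm_weight c k i * a i j)
  (fun k => \sum_i fm_weight c k i * b i) (fm_strict c s) reduced_supp).
- case=> x xP; left.
  have [|t tP] := @solve_one_variable R I c
      (fun i => b i - \sum_j a i j * x j) s.
    move=> k; have := xP k; rewrite -subr_lteifr0; congr (_ < _ ?<= if _).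
    under [in RHS]eq_bigr do rewrite mulrBr.
    rewrite sumrB; congr (_ - _).
    under eq_bigr do rewrite mulr_suml.
    rewrite exchange_big; apply: eq_bigr => i _; rewrite mulr_sumr.
    by apply: eq_bigr => j _; rewrite mulrA.
  (* The reduced system does not constrain [x j0], which need not be 0; hence [t] is added to it. *)
  exists (fun j => x j + (j == j0)%:R * t) => i; have := tP i.
  rewrite lteifBlDr; congr (_ < _ ?<= if _).
  under [in RHS]eq_bigr do rewrite mulrDr mulrCA.
  by rewrite big_split sum_deltal addrC mulrC.
- case=> mu [mu0 muA mub]; right.
  have exch f : \sum_i (\sum_k mu k * fm_weight c k i) * f i =
      \sum_k mu k * \sum_i fm_weight c k i * f i.
    under eq_bigr do rewrite mulr_suml.
    rewrite exchange_big; apply: eq_bigr => k _; rewrite mulr_sumr.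
    by apply: eq_bigr => i _; rewrite mulrA.
  exists (fun i => \sum_k mu k * fm_weight c k i); split => [i|j|].
  + by apply: sumr_ge0 => k _; rewrite mulr_ge0 ?fm_weight_ge0.
  + by rewrite exch.
  + rewrite exch; apply: lteif_imply mub; apply/implyP.
    case/existsP => k /andP[/existsP[i /andP[si wi]] muk].
    apply/existsP; exists i; rewrite si (bigD1 k) //=.
    rewrite ltr_pwDl ?mulr_gt0 // sumr_ge0 // => k' _.
    by rewrite mulr_ge0 ?fm_weight_ge0.
Qed.

Lemma motzkin {R : realFieldType} {N I : finType}
    (a : I -> N -> R) (b : I -> R) (s : pred I) :
  (exists x : N -> R, forall i, b i < \sum_j a i j * x j ?<= if ~~ s i) \/
  (exists mu : I -> R,
    [/\ forall i, 0 <= mu i,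
        forall j, \sum_i mu i * a i j = 0 &
        0 < \sum_i mu i * b i ?<= if [exists i, s i && (0 < mu i)]]).
Proof.
by apply: (@motzkin_supp _ _ (enum N)) => i j; rewrite mem_enum.
Qed.

(** * Core allocations that are strict on prescribed coalitions *)

(** Effectiveness disregards the collection [{N}], so the condition on [[set: N]] separately rules
    out the contradictory demand [x(N) > v(N) = b0]. *)
Lemma balanced_game_strict_core_nonempty {R : realType} {N : finType}
    (F D : {set {set N}}) (v : {set N} -> R) (b0 : R) :
  (0 < #|N|)%N -> set0 \notin F -> D \subset F ->
  ([set: N] \in D -> v [set: N] <> b0) ->
  balanced_game F v b0 -> effective F v b0 :&: D = set0 ->
  exists x : N -> R, \sum_j x j = b0 /\
    forall S, S \in F -> v S < \sum_(j in S) x j ?<= if (S \notin D).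
Proof.
move=> /card_gt0P[j1 _] F0 /subsetP DF DN bal eff.
(* [inl false] and [inl true] are the two halves of the equation x(N) = b0. *)
pose a (i : bool + {set N}) (j : N) : R :=
  match i with inl e => (-1) ^+ e | inr T => ((T \in F) && (j \in T))%:R end.
(* A set outside [F] gives the row [0 <= 0], which is not strict because [D] is contained in [F]. *)
pose b (i : bool + {set N}) : R :=
  match i with inl e => (-1) ^+ e * b0 | inr T => (T \in F)%:R * v T end.
pose s (i : bool + {set N}) := if i is inr T then T \in D else false.
case: (motzkin a b s) => [[x xP]|[mu [mu0 muA mub]]].
  exists x; split=> [|S SF].
    apply/eqP; rewrite eq_le.
    have := xP (inl true); have := xP (inl false).
    by rewrite /= -!mulr_sumr expr0 expr1 !mul1r !mulN1r lerN2 => -> ->.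
  have := xP (inr S); rewrite /= SF mul1r; congr (_ < _ ?<= if _).
  by rewrite [RHS]big_mkcond; apply: eq_bigr => j _; case: (j \in S);
    rewrite ?mul1r ?mul0r.
(* [c] is the net multiplier of the equation, moved to the other side. *)
pose m S := mu (inr S); pose c := mu (inl true) - mu (inl false).
pose B := [set S in F | 0 < m S].
have sumB (f : {set N} -> R) :
    \sum_S m S * ((S \in F)%:R * f S) = \sum_(S in B) m S * f S.
  rewrite [RHS]big_mkcond; apply: eq_bigr => S _; rewrite inE.
  case: (S \in F); rewrite ?mul1r ?mul0r ?mulr0 //=.
  by case: ltP => // mS; have /eqP -> : m S == 0;
    rewrite ?mul0r // eq_le mS mu0.
have sum1 j : \sum_(S in B) m S * indicator S j = c.
  have := muA j; rewrite big_sumType /= big_bool /= expr0 expr1 -sumB.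
  under eq_bigr do rewrite -mulnb natrM.
  under [in X in _ -> X]eq_bigr do rewrite ffunE.
  by rewrite /c /m; move: (\sum_S _) => t; lra.
have {}mub : c * b0 < \sum_(S in B) m S * v S
    ?<= if [exists S in D, 0 < m S].
  have := mub; rewrite big_sumType /= big_bool /= expr0 expr1 sumB.
  rewrite -[in X in _ -> X]subr_lteif0r => h.
  suff -> : [exists S in D, 0 < m S] = [exists i, s i && (0 < mu i)].
    by apply: etrans h; congr (_ < _ ?<= if _); rewrite /c; ring.
  apply/existsP/existsP => [[S ?]|[[e //|S ?]]]; first by exists (inr S).
  by exists S.
(* If [B] is empty, the identity at player [j1] gives [c = 0], and the certificate reduces to
   [0 < 0]. *)
have [B0|[S0 S0B]] := set_0Vmem B.
  move: mub; rewrite -(sum1 j1) B0 !big_set0 mul0r.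
  case: existsP => /= [[S /andP[SD mS]] _|_]; last by rewrite ltxx.
  by have SB : S \in B; [rewrite inE mS DF | rewrite B0 inE in SB].
have c0 : 0 < c.
  have S00 : S0 != set0.
    by apply: contraNneq F0 => <-; move: S0B; rewrite inE => /andP[].
  have /set0Pn[j jS] := S00; rewrite -(sum1 j) (bigD1 S0) //=.
  rewrite ltr_pwDl //.
    by rewrite ffunE jS mulr1; move: S0B; rewrite inE => /andP[].
  by apply: sumr_ge0 => S _; rewrite mulr_ge0 ?mu0 // ffunE ler0n.
pose lam S := m S / c.
have BF : B \subset F by apply/subsetP => S; rewrite inE => /andP[].
have lamE (f : {set N} -> R) :
    \sum_(S in B) lam S * f S = (\sum_(S in B) m S * f S) / c.
  by rewrite mulr_suml; apply: eq_bigr => S _; rewrite mulrAC.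
have lamB : balancing_weights B lam.
  split.
  - by apply: contra F0 => /(subsetP BF).
  - by move=> S; rewrite inE => /andP[_ mS]; rewrite divr_gt0.
  - by move=> j; rewrite lamE sum1 ffunE inE divff ?gt_eqF.
have lamv := bal B lam BF lamB.
(* Balancedness is the reverse of the certificate, so equality holds and some strict coalition has a
   positive multiplier. *)
move: mub; have := lamv; rewrite lamE ler_pdivrMr // mulrC => le1.
case: existsP => [[S /andP[SD mS]] /= ge1|_ /=]; last by rewrite ltNge le1.
have lamv_eq : \sum_(T in B) lam T * v T = b0.
  have -> : b0 = c * b0 / c by rewrite mulrC mulKf ?gt_eqF.
  by rewrite lamE; congr (_ / _); apply/eqP; rewrite eq_le le1 ge1.
have SB : S \in B by rewrite inE mS DF.
(* If [B] is [{N}], its weight is 1, so [v [set: N] = b0], which [DN] forbids. *)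
have [BN|BN] := eqVneq B [set [set: N]]; last first.
  have : S \in effective F v b0 :&: D.
    by rewrite !inE SD andbT; apply/asboolP; exists B, lam.
  by rewrite eff inE.
move: SB; rewrite BN inE => /eqP SN; rewrite SN in SD.
case: lamB => _ _ /(_ j1); move: lamv_eq.
rewrite BN !big_set1 !ffunE inE mulr1 => + lam1; rewrite lam1 mul1r.
by move/(DN SD).
Qed.

(** * From games back to cooperahedra *)

Theorem theorem3 (R : realType) (N : finType) (P : cooperahedron R N)
    (v : {set N} -> R)
    (hN : (0 < #|N|)%N)
    (hcoal : forall i : index_set P, coalition i != set0)
    (hv : associated_game P v)
    (hstrictN : [set: N] \in strict_coalitions P -> v [set: N] <> total_amount P) :
  (exists x : {ffun N -> R}, x \in solutions P) <->
  (balanced_game (set_system P) v (total_amount P) /\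
   effective (set_system P) v (total_amount P) :&: strict_coalitions P = set0).
Proof.
set b0 := total_amount P.
have coalition_ineq (x : {ffun N -> R}) (i : index_set P) : \sum_j x j = b0 ->
    ineq_holds (symb i) (dot (vec01 (normal_vector i)) x) (bound i) =
    (v (coalition i) < \sum_(j in coalition i) x j
      ?<= if ~~ ineq_strict (symb i)).
  move=> xN; have [hs hp] := hv.
  have dotE : dot (vec01 (normal_vector i)) x = \sum_(j | normal_vector i j) x j.
    rewrite [RHS]big_mkcond; apply: eq_bigr => j _; rewrite ffunE.
    by case: (normal_vector i j); rewrite ?mul1r ?mul0r.
  rewrite dotE; case: (boolP (ineq_prec (symb i))) => hi.
    rewrite (hp i) ?inE // /coalition inE hi /=.
    have -> : \sum_(j in [set j | ~~ normal_vector i j]) x j =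
              b0 - \sum_(j | normal_vector i j) x j.
      rewrite -xN [X in X - _](bigID (normal_vector i)) /= addrAC subrr add0r.
      by apply: eq_bigl => j; rewrite inE.
    by case: (symb i) hi => //= _; rewrite ?lerD2l ?ltrD2l ?lerN2 ?ltrN2.
  rewrite (hs i) ?inE // /coalition inE hi /=.
  have -> : \sum_(j in [set j | normal_vector i j]) x j =
            \sum_(j | normal_vector i j) x j.
    by apply: eq_bigl => j; rewrite inE.
  by case: (symb i) hi.
have dot_total (x : {ffun N -> R}) : dot (indicator [set: N]) x = \sum_j x j.
  by apply: eq_bigr => j _; rewrite ffunE inE mul1r.
split=> [[x]|[bal eff]].
  rewrite inE dot_total -/b0 => /andP[/eqP xN /forallP xP].
  (* Exchanging the sums, each player is counted with total weight 1. *)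
  have weighted (B : {set {set N}}) lam : balancing_weights B lam ->
      \sum_(S in B) lam S * (\sum_(j in S) x j) = b0.
    case=> _ _ lam1; rewrite -xN.
    under eq_bigr do rewrite mulr_sumr big_mkcond.
    rewrite exchange_big; apply: eq_bigr => j _.
    have /(congr1 ( *%R^~ (x j))) := lam1 j; rewrite mulr_suml.
    rewrite [X in _ = X * _]ffunE inE mul1r => lam1j; rewrite -[RHS]lam1j.
    apply: eq_bigr => S _; rewrite ffunE.
    by case: (j \in S); rewrite ?mulr1 ?mulr0 ?mul0r.
  have xv S : S \in set_system P -> v S <= \sum_(j in S) x j.
    by case/imsetP => i _ ->; have := xP i; rewrite coalition_ineq // => /lteifW.
  split=> [B lam BF lamB|].
    rewrite -(weighted _ _ lamB); apply: ler_sum => S SB.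
    case: lamB => _ /(_ S SB) lam0 _.
    by rewrite ler_wpM2l ?(ltW lam0) // xv // (subsetP BF).
  apply/eqP; rewrite setI_eq0; apply/pred0P => S /=; apply/negbTE/negP.
  rewrite inE => /andP[/asboolP[B [lam [BF _ lamB SB vB]]] /imsetP[i]].
  rewrite inE => istr Si.
  suff : \sum_(T in B) lam T * v T < b0 by rewrite vB ltxx.
  rewrite -(weighted _ _ lamB); case: lamB => _ lam0 _.
  (* The term of the strict coalition [S] has positive weight and makes the whole sum strict. *)
  rewrite (bigD1 S) //= [ltRHS](bigD1 S) //= ltr_leD //.
    rewrite ltr_pM2l ?lam0 //.
    by have := xP i; rewrite coalition_ineq // istr -Si.
  apply: ler_sum => T /andP[TB _].
  by rewrite ler_wpM2l ?(ltW (lam0 _ TB)) // xv // (subsetP BF).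
have [||x [xN xP]] :=
  balanced_game_strict_core_nonempty _ _ _ _ hN _ _ hstrictN bal eff.
- by apply/imsetP => -[i _ /esym/eqP]; apply/negP.
- by apply/subsetP => S /imsetP[i _ ->]; apply: imset_f.
exists (finfun x); rewrite inE dot_total.
have xN' : \sum_j finfun x j = b0 by under eq_bigr do rewrite ffunE.
rewrite xN' eqxx; apply/forallP => i; rewrite coalition_ineq //.
under eq_bigr do rewrite ffunE.
have := xP (coalition i) (imset_f _ isT).
(* A nonstrict index may share its coalition with a strict one; the strict bound then implies the
   weak one. *)
apply: lteif_imply; apply/implyP; apply: contra => istr.
by apply: imset_f; rewrite inE.
Qed.
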